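(* Let $\mathcal{Q}\subseteq\mathbb{R}^{n+1}$ be a compact set and define the mixed integer set $\mathcal{P}=\{(x;y)\in\mathcal{Q}\mid x\in\mathbb{Z}^n\}$, where $x\in\mathbb{R}^n$ denotes the first $n$ coordinates and $y\in\mathbb{R}$ the last coordinate. Then $\mathcal{P}$ is DD-representable with respect to $I=\{n+1\}$.
   Context: Let $m$ be a positive integer (here $m=n+1$) and $I\subseteq\{1,\dots,m\}$. A function $f:\mathbb{R}^m\to\mathbb{R}$ is convex in $x_I$ if, for any fixed real values of the coordinates not in $I$, the restriction of $f$ to the resulting affine subspace is convex. A decision diagram (DD) $\mathcal{D}=(\mathcal{U},\mathcal{A},l(\cdot))$ for $m$ variables is a finite layered directed acyclic multigraph with node layers $\mathcal{U}_1,\dots,\mathcal{U}_{m+1}$, where $\mathcal{U}_1=\{r\}$ (root) and $\mathcal{U}_{m+1}=\{t\}$ (terminal), and arc layers $\mathcal{A}_1,\dots,\mathcal{A}_m$, where arcs of $\mathcal{A}_i$ go from $\mathcal{U}_i$ to $\mathcal{U}_{i+1}$, with arc labels $l:\mathcal{A}\to\mathbb{R}$. Parallel arcs are allowed, and different arcs leaving a node may have equal labels. Each $r$-$t$ path $(a_1,\dots,a_m)$ encodes the point $(l(a_1),\dots,l(a_m))\in\mathbb{R}^m$; $\operatorname{Sol}(\mathcal{D})$ is the set of points encoded by all $r$-$t$ paths. A compact set $\mathcal{P}\subseteq\mathbb{R}^m$ is DD-representable w.r.t. $I$ if there exists a DD $\mathcal{D}$ such that $\max\{f(x)\mid x\in\mathcal{P}\}=\max\{f(x)\mid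 x\in\operatorname{Sol}(\mathcal{D})\}$ for every function $f$ that is convex in $x_I$. *)

(* Defs.v *)
From HB Require Import structures.
From mathcomp Require Import all_boot all_order all_algebra.
From mathcomp Require Import all_classical all_reals all_analysis.

Set Implicit Arguments.
Unset Strict Implicit.
Unset Printing Implicit Defensive.

Import Order.TTheory GRing.Theory Num.Theory.
Import numFieldNormedType.Exports.

Local Open Scope classical_set_scope.
Local Open Scope ring_scope.

Definition fiber (R : realType) (m : nat) (I : {set 'I_m}) (c : 'rV[R]_m) :
    set 'rV[R]_m :=
  [set x | forall i : 'I_m, i \notin I -> x 0 i = c 0 i].

Definition convex_in (R : realType) (m : nat) (I : {set 'I_m})
    (f : 'rV[R]_m -> R) : Prop :=
  forall c : 'rV[R]_m, convex_function (fiber I c) f.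

(* Layers are numbered from 0: nodes have layers 0, ..., m and an arc of the
   i-th arc layer (i < m) is one whose tail lies in node layer i; its head then
   lies in node layer i + 1.  Arcs form a type of their own, so parallel arcs
   and equal labels are possible.  A layer other than the first and the last
   may be empty. *)
Record decision_diagram (R : realType) (m : nat) := DecisionDiagram {
  dd_node : finType;
  dd_arc : finType;
  dd_layer : dd_node -> 'I_m.+1;
  dd_tail : dd_arc -> dd_node;
  dd_head : dd_arc -> dd_node;
  dd_label : dd_arc -> R;
  dd_root : dd_node;
  dd_terminal : dd_node;
  dd_root_layer : forall u, dd_layer u = ord0 <-> u = dd_root;
  dd_terminal_layer : forall u, dd_layer u = ord_max <-> u = dd_terminal;
  dd_arc_layer : forall a,
    nat_of_ord (dd_layer (dd_head a)) = (dd_layer (dd_tail a)).+1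
}.

(* [v] lists the m + 1 nodes visited by the m arcs of [p]. *)
Definition dd_path (R : realType) (m : nat) (D : decision_diagram R m)
    (p : 'I_m -> dd_arc D) : Prop :=
  exists v : 'I_m.+1 -> dd_node D,
    [/\ v ord0 = dd_root D,
        v ord_max = dd_terminal D &
        forall i : 'I_m, dd_tail (p i) = v (widen_ord (leqnSn m) i) /\
                         dd_head (p i) = v (lift ord0 i)].

Definition Sol (R : realType) (m : nat) (D : decision_diagram R m) :
    set 'rV[R]_m :=
  [set x | exists2 p : 'I_m -> dd_arc D,
     dd_path p & x = \row_(i < m) dd_label (p i)].

Definition is_max (R : realType) (A : set R) (v : R) : Prop :=
  A v /\ ubound A v.

(* The equality of the two maxima says that one exists iff the other does, with
   the same value.  Taking f constant shows that P is empty iff Sol D is, and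
   Sol D is finite; hence for P nonempty both maxima exist and are equal, while
   for P empty both sets are empty (max = -oo on both sides). *)
Definition DD_representable (R : realType) (m : nat) (I : {set 'I_m})
    (P : set 'rV[R]_m) : Prop :=
  compact P /\
  exists D : decision_diagram R m,
    forall f : 'rV[R]_m -> R, convex_in I f ->
      forall v : R, is_max (f @` P) v <-> is_max (f @` Sol D) v.

Definition mixed_integer_set (R : realType) (n : nat) (Q : set 'rV[R]_n.+1) :
    set 'rV[R]_n.+1 :=
  [set z | Q z /\
     forall i : 'I_n, z 0 (widen_ord (leqnSn n) i) \is a Num.int].

(* Main.v *)
Require Import Defs.
From mathcomp Require Import all_boot all_order all_algebra.
From mathcomp Require Import finmap.
From mathcomp Require Import all_classical all_reals all_analysis.
From mathcomp Require Import lra.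
Import numFieldNormedType.Exports.

Set Implicit Arguments.
Unset Strict Implicit.
Unset Printing Implicit Defensive.

Import Order.TTheory GRing.Theory Num.Theory.

Local Open Scope classical_set_scope.
Local Open Scope ring_scope.

(** A convex function on a segment is bounded by its values at the two ends.
    Hence, over the points of P sharing given integer coordinates x, a function
    convex in y is bounded by its larger value at the two points of P over x
    with extreme y; these exist because P is compact ([fiber_endpoints],
    [convex_in_le_max]).  Only finitely many x occur: distinct integer points
    are at distance at least 1, so the open ball of radius 1 at a point of P
    meets only the points of P over the same x ([mixed_integer_ball_fiber]), and
    finitely many such balls cover P ([finite_bracketing]).

    The resulting finite set S of end points lies in P and dominates P for
    every admissible function, so the maxima over S and P agree
    ([is_max_dominated]).  Finally, any finite set is the solution set of a
    decision diagram: draw one path per point, the paths meeting only at the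
    root and at the terminal ([Sol_finite_diagram]). *)

(** * Compactness and finiteness of mixed integer sets *)

Section CompactMixedInteger.
Variable R : realType.

(** Between consecutive integers there is none, so a non-integer x has the
    open neighborhood between floor x and floor x + 1 free of integers. *)
Lemma closed_int_num : closed [set x : R | x \is a Num.int].
Proof.
rewrite -openC openE => x /= xNint.
have fl_lt : (Num.floor x)%:~R < x.
  rewrite lt_neqAle floor_le andbT; apply/eqP => fx.
  by apply: xNint; rewrite /= -fx intr_int.
have := floorD1_gt x; rewrite -/(Num.floor x) => lt_fl.
near=> y => /= /intrP[k yk].
have : Num.floor x < k < Num.floor x + 1.
  rewrite -!(ltr_int R) -yk; apply/andP; split; near: y.
    exact: lt_nbhsr.
  exact: lt_nbhsl.
by rewrite ltzD1; case/andP => /lt_le_trans h /h; rewrite ltxx.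
Unshelve. all: by end_near. Qed.

Lemma compact_mixed_integer n (Q : set 'rV[R]_n.+1) :
  compact Q -> compact (mixed_integer_set Q).
Proof.
move=> cQ.
have -> : mixed_integer_set Q = Q `&` \bigcap_(i in [set: 'I_n])
    (fun z : 'rV[R]_n.+1 => z 0 (widen_ord (leqnSn n) i)) @^-1`
      [set x | x \is a Num.int].
  by apply/seteqP; split=> z /= [Qz zint]; split=> // i; [move=> _|]; exact: zint.
apply: compact_closedI => //; apply: closed_bigI => i _.
apply: preimage_closed => [z _|]; first exact: coord_continuous.
exact: closed_int_num.
Qed.

Lemma closed_fiber m (I : {set 'I_m}) (c : 'rV[R]_m) : closed (fiber I c).
Proof.
have -> : fiber I c = \bigcap_(i in [set i | i \notin I])
    (fun z : 'rV[R]_m => z 0 i) @^-1` [set c 0 i].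
  by apply/seteqP; split=> z /= zc i; exact: zc.
apply: closed_bigI => i _.
apply: preimage_closed => [z _|]; first exact: coord_continuous.
exact: closed_eq.
Qed.

(** The ball is open of radius 1 for the sup norm, so each integer coordinate
    of p and q differs by an integer of absolute value less than 1. *)
Lemma mixed_integer_ball_fiber n (Q : set 'rV[R]_n.+1) p q :
    mixed_integer_set Q p -> mixed_integer_set Q q -> ball p 1 q ->
  fiber [set ord_max]%SET p q.
Proof.
move=> [_ pint] [_ qint] [_ pq] i; rewrite inE => iNmax.
have [j ->] : exists j : 'I_n, i = widen_ord (leqnSn n) j.
  have ltin : (i < n)%N.
    by rewrite ltn_neqAle -ltnS ltn_ord andbT; apply: contra iNmax.
  by exists (Ordinal ltin); apply: val_inj.
apply/eqP; rewrite eq_sym -subr_eq0; apply: contraT => /norm_intr_ge1.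
rewrite rpredB ?pint ?qint// => /(_ isT); rewrite leNgt.
by rewrite (pq 0 (widen_ord (leqnSn n) j)).
Qed.

Lemma fiber_sym m (I : {set 'I_m}) (p q : 'rV[R]_m) :
  fiber I p q -> fiber I q p.
Proof. by move=> pq i iI; rewrite pq. Qed.

Lemma fiber_trans m (I : {set 'I_m}) (p q r : 'rV[R]_m) :
  fiber I p q -> fiber I q r -> fiber I p r.
Proof. by move=> pq qr i iI; rewrite qr ?pq. Qed.

Lemma fiber_endpoints m (P : set 'rV[R]_m) (I : {set 'I_m}) (i : 'I_m) p :
    compact P -> P p ->
  exists ab : 'rV[R]_m * 'rV[R]_m,
    [/\ P ab.1, P ab.2, fiber I p ab.1, fiber I p ab.2 &
      forall z, P z -> fiber I p z -> ab.1 0 i <= z 0 i <= ab.2 0 i].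
Proof.
move=> cP Pp.
have F0 : (P `&` fiber I p) !=set0 by exists p; split.
have cF : compact (P `&` fiber I p).
  by apply: compact_closedI => //; exact: closed_fiber.
have ci : {within P `&` fiber I p, continuous (fun z : 'rV[R]_m => z 0 i)}.
  exact/continuous_subspaceT/coord_continuous.
have [a] := EVT_min_rV F0 cF ci; rewrite inE => -[Pa pa] amin.
have [b] := EVT_max_rV F0 cF ci; rewrite inE => -[Pb pb] bmax.
exists (a, b); split => // z Pz pz.
by rewrite amin ?bmax ?inE.
Qed.

(** Finitely many unit balls centered in the set cover it, and each of them
    meets only the fiber of its center; the family [s] collects the two end
    points of these fibers. *)
Lemma finite_bracketing n (Q : set 'rV[R]_n.+1) : compact Q ->
  exists (K : finType) (s : K -> 'rV[R]_n.+1),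
    (forall k, mixed_integer_set Q (s k)) /\
    forall p, mixed_integer_set Q p -> exists j k,
      [/\ fiber [set ord_max]%SET p (s j), fiber [set ord_max]%SET p (s k) &
          s j 0 ord_max <= p 0 ord_max <= s k 0 ord_max].
Proof.
move=> /compact_mixed_integer; set P := mixed_integer_set Q => cP.
pose I : {set 'I_n.+1} := [set ord_max]%SET.
pose endpoints p (ab : 'rV[R]_n.+1 * 'rV[R]_n.+1) :=
  [/\ P ab.1, P ab.2, fiber I p ab.1, fiber I p ab.2 &
    forall z, P z -> fiber I p z ->
      ab.1 0 ord_max <= z 0 ord_max <= ab.2 0 ord_max].
have /choice[e eP] : forall p, exists ab, P p -> endpoints p ab.
  move=> p; have [Pp|nPp] := pselect (P p); last by exists (0, 0).
  by have [ab abP] := fiber_endpoints I ord_max cP Pp; exists ab.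
move: (cP); rewrite compact_cover => /(_ _ P (fun p => ball p 1)).
case=> [p _|p Pp|C CP Ccover]; first exact: ball_open.
  by exists p => //; exact: ballxx.
exists (C * bool)%type.
exists (fun kb => if kb.2 then (e (val kb.1)).2 else (e (val kb.1)).1).
have PC (c : C) : P (val c) by exact/set_mem/CP/fsvalP.
split=> [[c b] /=|p Pp]; first by have [Pa Pb] := eP _ (PC c); case: b.
have [c Cc cp] := Ccover _ Pp.
pose c' : C := [` Cc]%fset.
have cp' : fiber I c p.
  exact: mixed_integer_ball_fiber (PC c') Pp cp.
have [Pa Pb ca cb bd] := eP _ (PC c').
exists (c', false), (c', true) => /=; split; last exact: bd.
  exact: fiber_trans (fiber_sym cp') ca.
exact: fiber_trans (fiber_sym cp') cb.
Qed.

End CompactMixedInteger.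

(** * Convex functions of one coordinate *)

Lemma convex_in_le_max (R : realType) m (i : 'I_m) (f : 'rV[R]_m -> R)
    (a b z : 'rV[R]_m) :
    convex_in [set i]%SET f ->
    fiber [set i]%SET z a -> fiber [set i]%SET z b ->
    a 0 i <= z 0 i <= b 0 i ->
  f z <= Num.max (f a) (f b).
Proof.
move=> fconv za zb /andP[az zb'].
have [ab|ba] := ltP (a 0 i) (b 0 i); last first.
  suff -> : z = a by rewrite le_max lexx.
  apply/rowP => j; have [->|ji] := eqVneq j i; last by rewrite za ?inE.
  by apply/le_anti; rewrite az (le_trans zb').
have ba0 : 0 < b 0 i - a 0 i by rewrite subr_gt0.
(* the weight of a in z, read off the only coordinate where they differ *)
pose t := (b 0 i - z 0 i) / (b 0 i - a 0 i).
have t0 : 0 <= t by rewrite divr_ge0 ?subr_ge0// ltW.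
have t1 : t <= 1 by rewrite ler_pdivrMr// mul1r lerD2l lerN2.
have := fconv z (Itv01 t0 t1) a b (mem_set za) (mem_set zb).
have -> : conv (Itv01 t0 t1) (a : convex_lmodType _) (b : convex_lmodType _) = z.
  rewrite /conv /=; apply/rowP => j; rewrite !mxE.
  change (t * a 0 j + (1 - t) * b 0 j = z 0 j).
  have [->|ji] := eqVneq j i; last by rewrite za ?zb ?inE//; lra.
  have : t * (b 0 i - a 0 i) = b 0 i - z 0 i by rewrite /t divfK// gt_eqF.
  lra.
change (f z <= t * f a + (1 - t) * f b -> f z <= Num.max (f a) (f b)).
move=> /le_trans; apply.
have fa : f a <= Num.max (f a) (f b) by rewrite le_max lexx.
have fb : f b <= Num.max (f a) (f b) by rewrite le_max lexx orbT.
rewrite -[leRHS]mul1r -[X in _ <= X * _](subrKC t) [leRHS]mulrDl.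
by apply: lerD; apply: ler_wpM2l => //; rewrite subr_ge0.
Qed.

Lemma is_max_dominated (R : realType) (T : Type) (P S : set T) (f : T -> R) v :
    S `<=` P -> (forall p, P p -> exists2 s, S s & f p <= f s) ->
  is_max (f @` P) v <-> is_max (f @` S) v.
Proof.
move=> SP dom; split=> -[[p pA <-] ub]; split.
- have [s Ss fps] := dom _ pA; exists s => //; apply/le_anti.
  by rewrite fps andbT; apply: ub; exists s => //; exact: SP.
- by move=> _ [s Ss <-]; apply: ub; exists s => //; exact: SP.
- by exists p => //; exact: SP.
- move=> _ [q Pq <-]; have [s Ss fqs] := dom _ Pq.
  by apply: (le_trans fqs); apply: ub; exists s.
Qed.

(** * Decision diagrams of finite sets *)

(** The diagram of a family [s] of points consists of one strand per index k:
    a path from root to terminal whose i-th arc is labeled by the i-th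
    coordinate of [s k]. *)
Section FiniteDiagram.
Variables (R : realType) (m : nat) (K : finType) (s : K -> 'rV[R]_m.+1).

Definition end_layer (j : 'I_m.+2) := (j == ord0) || (j == ord_max).

(** [(Some k, j)] is the node of strand k in an inner layer j.  The first and
    last layers, common to all strands, have [None] as their only strand. *)
Definition strand_node :=
  {u : option K * 'I_m.+2 | (u.1 == None) == end_layer u.2}.

Lemma strand_proof (k : K) (j : 'I_m.+2) :
  ((if end_layer j then None else Some k) == None) == end_layer j.
Proof. by case: (end_layer j). Qed.

Definition strand (k : K) (j : 'I_m.+2) : strand_node :=
  exist _ (if end_layer j then None else Some k, j) (strand_proof k j).

Definition strand_root : strand_node := exist _ (None, ord0) isT.

Lemma strand_terminal_proof : (None == None :> option K) == end_layer ord_max.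
Proof. by rewrite /end_layer [ord_max == ord_max]eqxx orbT. Qed.

Definition strand_terminal : strand_node :=
  exist _ (None, ord_max) strand_terminal_proof.

Definition strand_layer (u : strand_node) : 'I_m.+2 := (val u).2.

Lemma strand_end_layerP (u v : strand_node) : end_layer (strand_layer v) ->
  strand_layer u = strand_layer v <-> u = v.
Proof.
move=> ev; split=> [uv|->//].
case: u v ev uv => [[ku ju] pu] [[kv jv] pv]; rewrite /strand_layer /= => ev juv.
apply: val_inj => /=; move: pu pv => /=; rewrite juv ev !eqb_id.
by move=> /eqP -> /eqP ->.
Qed.

Lemma strand_root_layer u : strand_layer u = ord0 <-> u = strand_root.
Proof. exact: (@strand_end_layerP _ strand_root). Qed.

Lemma strand_terminal_layer u :
  strand_layer u = ord_max <-> u = strand_terminal.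
Proof.
by apply: (@strand_end_layerP _ strand_terminal); rewrite /end_layer eqxx orbT.
Qed.

Definition strand_tail (a : K * 'I_m.+1) :=
  strand a.1 (widen_ord (leqnSn m.+1) a.2).
Definition strand_head (a : K * 'I_m.+1) := strand a.1 (lift ord0 a.2).

Lemma strand_arc_layer a :
  nat_of_ord (strand_layer (strand_head a)) = (strand_layer (strand_tail a)).+1.
Proof. by []. Qed.

Definition finite_diagram : decision_diagram R m.+1 :=
  DecisionDiagram (fun a : K * 'I_m.+1 => s a.1 0 a.2)
    strand_root_layer strand_terminal_layer strand_arc_layer.

(** Strands are disjoint on inner layers, so that a path can only switch
    strands at its ends. *)
Lemma strand_inj (k l : K) (i j : 'I_m.+2) : ~~ end_layer i ->
  strand k i = strand l j -> k = l.
Proof.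
move=> iNe /(congr1 val) /= [+ ij]; rewrite -ij (negbTE iNe).
by case.
Qed.

Lemma Sol_finite_diagram : Sol finite_diagram = range s.
Proof.
apply/seteqP; split=> [x [p [v [v0 vmax vp]] ->]|_ [k _ <-]]; last first.
  exists (fun i => (k, i)); last by apply/rowP => i; rewrite mxE.
  exists (strand k); split=> //=.
    exact/strand_root_layer.
  exact/strand_terminal_layer.
(* a path visits the layers in order, so its i-th arc lies in arc layer i *)
have vlayer (j : 'I_m.+2) : strand_layer (v j) = j.
  apply: val_inj; case: j => j; elim: j => [|j IH] ltj.
    have -> : Ordinal ltj = ord0 :> 'I_m.+2 by apply: ord_inj.
    by rewrite v0.
  have ltj' : (j < m.+1)%N by [].
  have [tl hd] := vp (Ordinal ltj').
  have -> : Ordinal ltj = lift ord0 (Ordinal ltj') by exact: val_inj.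
  have := dd_arc_layer (p (Ordinal ltj')); rewrite hd tl => hdl.
  apply: (etrans hdl); congr _.+1.
  have -> : widen_ord (leqnSn m.+1) (Ordinal ltj') = Ordinal (ltnW ltj).
    exact: val_inj.
  exact: IH.
have pi2 (i : 'I_m.+1) : (p i).2 = i.
  have [tl _] := vp i; apply: val_inj.
  have := congr1 (fun u => nat_of_ord (strand_layer u)) tl.
  by rewrite vlayer.
(* consecutive arcs meet in an inner layer, hence lie on the same strand *)
have p1 (i : 'I_m.+1) : (p i).1 = (p ord0).1.
  case: i => i; elim: i => [|i IH] lti; first by congr (p _).1; exact: val_inj.
  rewrite -(IH (ltnW lti)).
  have [_ hd] := vp (Ordinal (ltnW lti)); have [tl _] := vp (Ordinal lti).
  have eqv : lift ord0 (Ordinal (ltnW lti)) =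
      widen_ord (leqnSn m.+1) (Ordinal lti) by exact: val_inj.
  rewrite -eqv -hd in tl.
  apply: strand_inj tl; rewrite pi2 /end_layer negb_or -!val_eqE /=.
  by rewrite ltn_eqF.
exists (p ord0).1 => //; apply/rowP => i.
by rewrite mxE /= pi2 (p1 i).
Qed.

End FiniteDiagram.

Theorem corollary2 (R : realType) (n : nat) (Q : set 'rV[R]_n.+1)
    (hQ : compact Q) :
  DD_representable [set ord_max]%SET (mixed_integer_set Q).
Proof.
split; first exact: compact_mixed_integer.
have [K [s [sP brackets]]] := finite_bracketing hQ.
exists (finite_diagram s) => f fconv v.
rewrite Sol_finite_diagram; apply: is_max_dominated.
  by move=> _ [k _ <-]; exact: sP.
move=> p /brackets[j [k [pj pk jpk]]].
have := convex_in_le_max fconv pj pk jpk.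
by rewrite le_max => /orP[?|?]; [exists (s j)|exists (s k)].
Qed.
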